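(* Let $C_8\approx0.6817039304$ be the smallest positive root of $896x^4-2184x^3+1924x^2-758x+121$. For every triangle, the following bounds hold, where a bound $L\le \frac{D(n,i)}{D(n,j)}\le U$ means $L\,D(n,j)\le D(n,i)\le U\,D(n,j)$ (and similarly for one-sided bounds and equalities): $$\frac{D(8,1)}{D(8,2)}=\frac32,\quad \frac{D(8,1)}{D(8,4)}\le1,\quad \frac{D(8,1)}{D(8,5)}\le\frac43,\quad \frac27\left(4-\sqrt2\right)\le\frac{D(8,1)}{D(8,6)}\le1,\quad \frac12\le\frac{D(8,1)}{D(8,7)}\le1,\quad 2\le\frac{D(8,1)}{D(8,9)},\quad \frac{D(8,1)}{D(8,10)}=2,$$ $$\frac{D(8,2)}{D(8,4)}\le\frac23,\quad \frac{D(8,2)}{D(8,5)}\le\frac89,\quad \frac4{21}\left(4-\sqrt2\right)\le\frac{D(8,2)}{D(8,6)}\le\frac23,\quad \frac13\le\frac{D(8,2)}{D(8,7)}\le\frac23,\quad \frac43\le\frac{D(8,2)}{D(8,9)},\quad \frac{D(8,2)}{D(8,10)}=\frac43,$$ $$\frac{D(8,3)}{D(8,4)}\le\frac12,\quad \frac{D(8,3)}{D(8,5)}\le2,\quad \frac43\le\frac{D(8,4)}{D(8,5)}\le4,\quad 1\le\frac{D(8,4)}{D(8,6)},\quad 1\le\frac{D(8,4)}{D(8,7)},\quad 2\le\frac{D(8,4)}{D(8,9)},\quad 2\le\frac{D(8,4)}{D(8,10)},$$ $$C_8\le\frac{D(8,5)}{D(8,6)},\quad \frac18\left(3+2\sqrt2\right)\le\frac{D(8,5)}{D(8,7)},\quad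 \frac32\le\frac{D(8,5)}{D(8,9)},\quad \frac32\le\frac{D(8,5)}{D(8,10)},$$ $$\frac23\le\frac{D(8,6)}{D(8,7)}\le\frac76,\quad 2\le\frac{D(8,6)}{D(8,9)},\quad 2\le\frac{D(8,6)}{D(8,10)}\le2+\frac1{\sqrt2},\quad 2\le\frac{D(8,7)}{D(8,9)},\quad 2\le\frac{D(8,7)}{D(8,10)}\le4,\quad \frac{D(8,9)}{D(8,10)}\le1.$$
   Context: For a (nondegenerate) triangle $ABC$ with side lengths $a=BC$, $b=CA$, $c=AB$, a point with barycentric coordinates $(u:v:w)$ is $(uA+vB+wC)/(u+v+w)$. For $1\le n\le 10$ the triangle center $X_n$ is the point with barycentric coordinates $(f_n(a,b,c):f_n(b,c,a):f_n(c,a,b))$, where $f_1=a$ (incenter); $f_2=1$ (centroid); $f_3=a^2(a^2-b^2-c^2)$ (circumcenter); $f_4=(a^2+b^2-c^2)(a^2-b^2+c^2)$ (orthocenter); $f_5=c^4-a^2b^2+b^4-a^2c^2-2b^2c^2$ (nine-point center); $f_6=a^2$ (symmedian point); $f_7=(a+b-c)(a-b+c)$ (Gergonne point); $f_8=a-b-c$ (Nagel point); $f_9=a(a-b-c)$ (mittenpunkt); $f_{10}=b+c$ (Spieker center). $D(i,j)$ denotes the Euclidean distance between $X_i$ and $X_j$. *)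

(* Defs.v *)
From Stdlib Require Export Reals.
Open Scope R_scope.

Definition point : Type := (R * R)%type.

Definition pdist (P Q : point) : R := dist_euc (fst P) (snd P) (fst Q) (snd Q).

Definition collinear (P Q S : point) : Prop :=
  (fst Q - fst P) * (snd S - snd P) = (fst S - fst P) * (snd Q - snd P).

Record plane_triangle : Type := PlaneTriangle {
  vA : point;
  vB : point;
  vC : point;
  nondegenerate : ~ collinear vA vB vC
}.

Definition barycentric (T : plane_triangle) (u v w : R) : point :=
  ((u * fst (vA T) + v * fst (vB T) + w * fst (vC T)) / (u + v + w),
   (u * snd (vA T) + v * snd (vB T) + w * snd (vC T)) / (u + v + w)).

(* First barycentric coordinate of the n-th center (1 <= n <= 10) as a function
   of the side lengths; the value 0 for other n is junk. *)
Definition center_fun (n : nat) (a b c : R) : R :=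
  match n with
  | 1%nat => a
  | 2%nat => 1
  | 3%nat => a ^ 2 * (a ^ 2 - b ^ 2 - c ^ 2)
  | 4%nat => (a ^ 2 + b ^ 2 - c ^ 2) * (a ^ 2 - b ^ 2 + c ^ 2)
  | 5%nat => c ^ 4 - a ^ 2 * b ^ 2 + b ^ 4 - a ^ 2 * c ^ 2 - 2 * b ^ 2 * c ^ 2
  | 6%nat => a ^ 2
  | 7%nat => (a + b - c) * (a - b + c)
  | 8%nat => a - b - c
  | 9%nat => a * (a - b - c)
  | 10%nat => b + c
  | _ => 0
  end.

Definition X (T : plane_triangle) (n : nat) : point :=
  let a := pdist (vB T) (vC T) in
  let b := pdist (vC T) (vA T) in
  let c := pdist (vA T) (vB T) in
  barycentric T (center_fun n a b c) (center_fun n b c a) (center_fun n c a b).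

Definition D (T : plane_triangle) (i j : nat) : R := pdist (X T i) (X T j).

Definition quartic8 (x : R) : R :=
  896 * x ^ 4 - 2184 * x ^ 3 + 1924 * x ^ 2 - 758 * x + 121.

Definition smallest_positive_root (p : R -> R) (x : R) : Prop :=
  0 < x /\ p x = 0 /\ forall y : R, 0 < y -> p y = 0 -> x <= y.

(* Main.v *)
Require Import Defs.
From Stdlib Require Import Reals Lra Lia Psatz.
Open Scope R_scope.

(* Scale the triangle to circumradius 1; let r be its inradius and p its squared
   semiperimeter. Every D(8,n)^2 is a rational function of r and p, affine in p
   unless n = 6. Write r = (1 - d^2) / 2; by Blundon's inequality p runs over
   the interval whose endpoints belong to the two isosceles triangles with that
   r. So an inequality without X_6 need only be checked for isosceles triangles,
   where all the distances are |t| times a rational function of t, with t = d or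
   t = - d. In q = p - r^2 - 4 r, D(8,6)^2 is concave and has slope at least 1;
   this reduces the inequalities with X_6 to one of the endpoints, up to a
   tangent estimate in the ratios (6,7) and (5,6). The constant C_8 is the
   minimum of D(8,5) / D(8,6) over isosceles triangles. *)

(** * Barycentric distances and the Ravi substitution *)

(** The classical quadratic form for the squared length of a displacement whose normalized
    barycentric coordinates [p], [q], [r] sum to zero. *)
Definition bary_sqdist (a b c u v w u' v' w' : R) : R :=
  let p := u / (u + v + w) - u' / (u' + v' + w') in
  let q := v / (u + v + w) - v' / (u' + v' + w') in
  let r := w / (u + v + w) - w' / (u' + v' + w') in
  - (a ^ 2 * q * r + b ^ 2 * r * p + c ^ 2 * p * q).

Lemma pdist_sq (P Q : point) :
  pdist P Q ^ 2 = (fst P - fst Q) ^ 2 + (snd P - snd Q) ^ 2.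
Proof.
  unfold pdist, dist_euc. rewrite pow2_sqrt; [unfold Rsqr; ring |].
  apply Rplus_le_le_0_compat; apply Rle_0_sqr.
Qed.

Lemma pdist_nonneg (P Q : point) : 0 <= pdist P Q.
Proof. apply sqrt_pos. Qed.

Lemma pdist_barycentric (T : plane_triangle) (u v w u' v' w' : R) :
  u + v + w <> 0 -> u' + v' + w' <> 0 ->
  pdist (barycentric T u v w) (barycentric T u' v' w') =
  sqrt (bary_sqdist (pdist (vB T) (vC T)) (pdist (vC T) (vA T))
          (pdist (vA T) (vB T)) u v w u' v' w').
Proof.
  intros H H'. unfold bary_sqdist. rewrite !pdist_sq.
  unfold pdist at 1, dist_euc, barycentric, Rsqr; simpl fst; simpl snd.
  f_equal. field. split; assumption.
Qed.

(** By Heron the product is 16 times the squared area; in coordinates it is 4 times the square of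
    the determinant that vanishes for collinear vertices. *)
Lemma heron_pos (T : plane_triangle) :
  let a := pdist (vB T) (vC T) in
  let b := pdist (vC T) (vA T) in
  let c := pdist (vA T) (vB T) in
  0 < (a + b + c) * (b + c - a) * (c + a - b) * (a + b - c).
Proof.
  intros a b c.
  replace ((a + b + c) * (b + c - a) * (c + a - b) * (a + b - c))
    with (4 * a ^ 2 * b ^ 2 - (a ^ 2 + b ^ 2 - c ^ 2) ^ 2) by ring.
  unfold a, b, c; rewrite !pdist_sq.
  destruct T as [[xA yA] [xB yB] [xC yC] nd]; unfold collinear in nd.
  simpl in *.
  match goal with |- 0 < ?e => replace e with
    (4 * ((xB - xA) * (yC - yA) - (xC - xA) * (yB - yA)) ^ 2) by ring end.
  assert ((xB - xA) * (yC - yA) - (xC - xA) * (yB - yA) <> 0) by lra.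
  apply Rmult_lt_0_compat; [lra | nra].
Qed.

Lemma ravi_substitution (T : plane_triangle) :
  exists x y z : R, 0 < x /\ 0 < y /\ 0 < z /\
    pdist (vB T) (vC T) = y + z /\
    pdist (vC T) (vA T) = z + x /\
    pdist (vA T) (vB T) = x + y.
Proof.
  pose proof (heron_pos T) as H; simpl in H.
  pose proof (pdist_nonneg (vB T) (vC T)) as Ha.
  pose proof (pdist_nonneg (vC T) (vA T)) as Hb.
  pose proof (pdist_nonneg (vA T) (vB T)) as Hc.
  revert H Ha Hb Hc.
  generalize (pdist (vB T) (vC T)) (pdist (vC T) (vA T)) (pdist (vA T) (vB T)).
  intros a b c H Ha Hb Hc.
  (* In the uses below [u + v] and [u + w] are twice side lengths, so [u <= 0] would force [v] and
     [w] to be nonnegative and the product could not be positive. *)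
  assert (pos : forall s u v w, 0 <= s -> 0 <= u + v -> 0 <= u + w ->
            0 < s * u * v * w -> 0 < u).
  { intros s u v w Hs Hv Hw Hp.
    destruct (Rlt_or_le 0 u) as [|Hu]; [assumption | exfalso].
    assert (0 <= v) by lra. assert (0 <= w) by lra.
    assert (0 <= s * v * w) by (repeat apply Rmult_le_pos; assumption).
    replace (s * u * v * w) with (s * v * w * u) in Hp by ring. nra. }
  exists ((b + c - a) / 2), ((c + a - b) / 2), ((a + b - c) / 2).
  assert (0 < b + c - a)
    by (apply (pos (a + b + c) _ (c + a - b) (a + b - c)); lra).
  assert (0 < c + a - b)
    by (apply (pos (a + b + c) _ (b + c - a) (a + b - c)); lra).
  assert (0 < a + b - c)
    by (apply (pos (a + b + c) _ (b + c - a) (c + a - b)); lra).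
  repeat split; lra.
Qed.

(** * Distances from the Nagel point *)

(* D(8,n)^2 / R^2 for r = inradius / R and p = (semiperimeter / R)^2. *)
Definition sqdist8 (n : nat) (r p : R) : R :=
  match n with
  | 1%nat => p + 5 * r ^ 2 - 16 * r
  | 2%nat => 4 / 9 * (p + 5 * r ^ 2 - 16 * r)
  | 3%nat => (1 - 2 * r) ^ 2
  | 4%nat => 4 * (1 - 2 * r)
  | 5%nat => p / 2 + 3 / 2 * r ^ 2 - 8 * r + 1 / 4
  | 6%nat =>
      let q := p - r ^ 2 - 4 * r in
      q - 8 * r + 8 * r ^ 2 - (44 * r ^ 2 - 8 * r ^ 3 - 4 * r ^ 4) / q
      - (48 * r ^ 3 + 12 * r ^ 4) / q ^ 2
  | 7%nat => 16 * ((1 + r) * p - r ^ 3 - 8 * r ^ 2 - 16 * r) / (4 + r) ^ 2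
  | 9%nat => ((4 - r ^ 2) * p + 3 * r ^ 4 + 20 * r ^ 3 + 16 * r ^ 2 - 64 * r)
             / (4 + r) ^ 2
  | 10%nat => 1 / 4 * (p + 5 * r ^ 2 - 16 * r)
  | _ => 0
  end.


(** Since [(x + y + z) * (x * y * z)] is the squared area, [V] is the squared circumradius. In Ravi
    coordinates the formula is a rational identity; the nonzero coordinate sum makes the center well
    defined. *)
Lemma bary_sqdist_nagel (n : nat) (x y z : R) :
  0 < x -> 0 < y -> 0 < z -> (1 <= n <= 10)%nat ->
  let a := y + z in
  let b := z + x in
  let c := x + y in
  let V := (a * b * c) ^ 2 / (16 * (x + y + z) * (x * y * z)) in
  center_fun n a b c + center_fun n b c a + center_fun n c a b <> 0 /\
  bary_sqdist a b c
    (center_fun 8 a b c) (center_fun 8 b c a) (center_fun 8 c a b)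
    (center_fun n a b c) (center_fun n b c a) (center_fun n c a b) =
  V * sqdist8 n (4 * (x * y * z) / (a * b * c)) ((x + y + z) ^ 2 / V).
Proof.
  intros hx hy hz hn a b c V; unfold V, a, b, c; clear V a b c.
  assert (hxy : 0 < x * y) by nra. assert (hyz : 0 < y * z) by nra.
  assert (hzx : 0 < z * x) by nra. assert (hxyz : 0 < x * y * z) by nra.
  assert (h2 : 0 < x * y + y * z + z * x) by lra.
  assert (h3 : 0 < (x + y + z) * (x * y * z)) by nra.
  assert (hs : 0 < x ^ 2 + y ^ 2 + z ^ 2) by nra.
  assert (nz : forall e k m : R, 0 < m -> k <> 0 -> e = k * m -> e <> 0)
    by (intros e k m Hm Hk ->; apply Rmult_integral_contrapositive; lra).
  assert (h6 : 0 < (x + y + z) * (x * y * z) *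
                   (x ^ 2 + y ^ 2 + z ^ 2 + (x * y + y * z + z * x)))
    by (apply Rmult_lt_0_compat; lra).
  destruct n as [|[|[|[|[|[|[|[|[|[|[|n]]]]]]]]]]]; try (exfalso; lia);
    unfold bary_sqdist, sqdist8, center_fun; cbv zeta;
    (split; [|field; repeat split]);
    try (apply Rgt_not_eq; lra);
    (* The first seven entries factor the coordinate sums of X_8, X_9, X_7, X_6, X_3, X_4, X_5; the
       eighth is the numerator of [q], by which the case n = 6 divides. *)
    first
      [ apply (nz _ (-2) (x + y + z)); [lra | lra | ring]
      | apply (nz _ (-4) (x * y + y * z + z * x)); [lra | lra | ring]
      | apply (nz _ 4 (x * y + y * z + z * x)); [lra | lra | ring]
      | apply (nz _ 2 (x ^ 2 + y ^ 2 + z ^ 2 + (x * y + y * z + z * x)));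
        [lra | lra | ring]
      | apply (nz _ (-16) ((x + y + z) * (x * y * z))); [lra | lra | ring]
      | apply (nz _ 16 ((x + y + z) * (x * y * z))); [lra | lra | ring]
      | apply (nz _ (-32) ((x + y + z) * (x * y * z))); [lra | lra | ring]
      | apply (nz _ 16 ((x + y + z) * (x * y * z) *
                 (x ^ 2 + y ^ 2 + z ^ 2 + (x * y + y * z + z * x))));
        [lra | lra | ring]
      | apply Rgt_not_eq; nra ].
Qed.

(** * Blundon's inequality *)

Lemma sq_le_inv (m k : R) : 0 <= k -> m ^ 2 <= k ^ 2 -> - k <= m <= k.
Proof. intros; split; nra. Qed.

(* For R = 1, the isosceles triangle with R (R - 2 r) = t ^ 2 has squared
   semiperimeter [isosceles_p t]; t and - t give the two such triangles. *)
Definition isosceles_p (t : R) : R := (1 - t) * (3 + t) ^ 3 / 4.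

(* Blundon's inequality: for given R and r the semiperimeter lies between those
   of the two isosceles triangles. *)
Lemma blundon (x y z : R) :
  0 < x -> 0 < y -> 0 < z ->
  let abc := (y + z) * (z + x) * (x + y) in
  let V := abc ^ 2 / (16 * (x + y + z) * (x * y * z)) in
  let r := 4 * (x * y * z) / abc in
  let p := (x + y + z) ^ 2 / V in
  exists d : R, 0 <= d < 1 /\ r = (1 - d ^ 2) / 2 /\
    isosceles_p d <= p <= isosceles_p (- d).
Proof.
  intros hx hy hz abc V r p.
  assert (habc : 0 < abc)
    by (unfold abc; repeat apply Rmult_lt_0_compat; lra).
  assert (hxyz : 0 < x * y * z) by (repeat apply Rmult_lt_0_compat; lra).
  assert (hr : 0 < r) by (apply Rdiv_lt_0_compat; lra).
  assert (euler : 0 <= 1 - 2 * r).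
  { replace (1 - 2 * r) with ((abc - 8 * (x * y * z)) / abc)
      by (unfold r; field; lra).
    apply Rmult_le_pos; [|left; apply Rinv_0_lt_compat; lra].
    replace (abc - 8 * (x * y * z))
      with (x * (y - z) ^ 2 + y * (z - x) ^ 2 + z * (x - y) ^ 2)
      by (unfold abc; ring).
    repeat apply Rplus_le_le_0_compat;
      (apply Rmult_le_pos; [lra | apply pow2_ge_0]). }
  (* The square in the identity below is the discriminant of the cubic with roots [x], [y], [z]. It
     vanishes exactly for isosceles triangles, which makes them extremal. *)
  assert (disc : 0 <= 4 * (1 - 2 * r) ^ 3 - (p - (2 + 10 * r - r ^ 2)) ^ 2).
  { replace (4 * (1 - 2 * r) ^ 3 - (p - (2 + 10 * r - r ^ 2)) ^ 2)
      with (((x - y) * (y - z) * (z - x)) ^ 2 *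
            (64 * (x + y + z) ^ 3 * (x * y * z)) / abc ^ 4).
    2:{ unfold p, r, V, abc; field; repeat split; apply Rgt_not_eq; lra. }
    apply Rmult_le_pos; [|left; apply Rinv_0_lt_compat, pow_lt; lra].
    apply Rmult_le_pos; [apply pow2_ge_0|].
    apply Rmult_le_pos; [|lra].
    apply Rmult_le_pos; [lra|]. apply pow_le; lra. }
  (* By Euler's formula OI^2 = R (R - 2 r), this is the distance from circumcenter to incenter when
     R = 1. *)
  exists (sqrt (1 - 2 * r)).
  pose proof (sqrt_pos (1 - 2 * r)) as hd.
  pose proof (pow2_sqrt _ euler) as hd2.
  set (d := sqrt (1 - 2 * r)) in *; clearbody d p r.
  assert (hd3 : (p - (2 + 10 * r - r ^ 2)) ^ 2 <= (2 * d ^ 3) ^ 2)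
    by (replace ((2 * d ^ 3) ^ 2) with (4 * (d ^ 2) ^ 3) by ring;
        rewrite hd2; lra).
  assert (0 <= 2 * d ^ 3) by (apply Rmult_le_pos; [lra | apply pow_le; lra]).
  assert (hp : - (2 * d ^ 3) <= p - (2 + 10 * r - r ^ 2) <= 2 * d ^ 3)
    by (apply sq_le_inv; assumption).
  replace r with ((1 - d ^ 2) / 2) in hp by lra.
  assert (h1 : isosceles_p d =
               2 + 10 * ((1 - d ^ 2) / 2) - ((1 - d ^ 2) / 2) ^ 2 - 2 * d ^ 3)
    by (unfold isosceles_p; field).
  assert (h2 : isosceles_p (- d) =
               2 + 10 * ((1 - d ^ 2) / 2) - ((1 - d ^ 2) / 2) ^ 2 + 2 * d ^ 3)
    by (unfold isosceles_p; field).
  assert (d < 1) by (apply Rnot_le_lt; intro; clear - hr hd2 H0; nra).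
  repeat split; lra.
Qed.

(** From here on the triangle enters only through these four numbers, and the common factor [V]
    cancels from every ratio. *)
Lemma D_nagel (T : plane_triangle) :
  exists V r p d : R,
    0 <= d < 1 /\ r = (1 - d ^ 2) / 2 /\
    isosceles_p d <= p <= isosceles_p (- d) /\
    0 <= V /\
    forall n : nat, (1 <= n <= 10)%nat -> D T 8 n = sqrt (V * sqdist8 n r p).
Proof.
  destruct (ravi_substitution T) as (x & y & z & hx & hy & hz & ha & hb & hc).
  destruct (blundon x y z hx hy hz) as (d & hd & hr & hp).
  exists (((y + z) * (z + x) * (x + y)) ^ 2
          / (16 * (x + y + z) * (x * y * z))).
  do 3 eexists. split; [exact hd|]. split; [exact hr|]. split; [exact hp|].
  split.
  - apply Rmult_le_pos; [apply pow2_ge_0|].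
    left; apply Rinv_0_lt_compat.
    assert (0 < (x + y + z) * (x * y * z))
      by (repeat apply Rmult_lt_0_compat; lra).
    lra.
  - intros n hn.
    destruct (bary_sqdist_nagel n x y z hx hy hz hn) as [hs <-].
    destruct (bary_sqdist_nagel 8 x y z hx hy hz ltac:(lia)) as [h8 _].
    unfold D, X; rewrite pdist_barycentric; rewrite ha, hb, hc; auto.
Qed.

(** * Isosceles triangles and the inequalities affine in p *)

(* In the notation of [isosceles_p], D(8,n) = |t| * isosceles_dist n t. *)
Definition isosceles_dist (n : nat) (t : R) : R :=
  match n with
  | 1%nat => 1 - t
  | 2%nat => 2 / 3 * (1 - t)
  | 3%nat => Rabs t
  | 4%nat => 2
  | 5%nat => (2 - t) / 2
  | 6%nat => (1 - t) * (t ^ 2 + 3 * t + 4) / (t ^ 2 + 2 * t + 3)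
  | 7%nat => 4 * (1 - t) / (3 - t)
  | 9%nat => (1 - t) ^ 2 / (3 - t)
  | 10%nat => (1 - t) / 2
  | _ => 0
  end.

Lemma isosceles_dist_nonneg (n : nat) (t : R) :
  -1 < t < 1 -> 0 <= isosceles_dist n t.
Proof.
  intros ht.
  destruct n as [|[|[|[|[|[|[|[|[|[|[|n]]]]]]]]]]]; simpl; try lra;
    try apply Rabs_pos;
    (apply Rmult_le_pos; [nra | left; apply Rinv_0_lt_compat; nra]).
Qed.

(** All centers of an isosceles triangle lie on its axis, which is why each squared distance becomes
    a perfect square. *)
Lemma sqdist8_isosceles (n : nat) (t : R) :
  -1 < t < 1 ->
  sqdist8 n ((1 - t ^ 2) / 2) (isosceles_p t) = (t * isosceles_dist n t) ^ 2.
Proof.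
  intros ht.
  destruct n as [|[|[|[|[|[|[|[|[|[|[|n]]]]]]]]]]];
    unfold sqdist8, isosceles_dist, isosceles_p; cbv zeta; try field;
    try (split; nra); try nra.
  - rewrite Rpow_mult_distr, pow2_abs; field.
  - split; [nra|].
    match goal with |- ?e <> 0 =>
      replace e with (4 * ((1 - t) * (3 + t) * (t ^ 2 + 2 * t + 3)))
        by ring end.
    apply Rgt_not_eq, Rmult_lt_0_compat; [lra|].
    repeat apply Rmult_lt_0_compat; nra.
Qed.

Lemma sqdist8_affine (n : nat) (r p1 p2 w : R) :
  n <> 6%nat ->
  sqdist8 n r ((1 - w) * p1 + w * p2) =
  (1 - w) * sqdist8 n r p1 + w * sqdist8 n r p2.
Proof.
  intros hn.
  destruct n as [|[|[|[|[|[|[|[|[|[|[|n]]]]]]]]]]]; try lia;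
    unfold sqdist8, Rdiv; ring.
Qed.

Lemma isosceles_p_gap (d : R) : isosceles_p (- d) - isosceles_p d = 4 * d ^ 3.
Proof. unfold isosceles_p; field. Qed.

Lemma isosceles_compare (i j : nat) (k t : R) :
  -1 < t < 1 -> 0 <= k -> k * isosceles_dist j t <= isosceles_dist i t ->
  k ^ 2 * sqdist8 j ((1 - t ^ 2) / 2) (isosceles_p t) <=
  sqdist8 i ((1 - t ^ 2) / 2) (isosceles_p t).
Proof.
  intros ht hk h. rewrite !sqdist8_isosceles by assumption.
  rewrite !Rpow_mult_distr.
  replace (k ^ 2 * (t ^ 2 * isosceles_dist j t ^ 2))
    with (t ^ 2 * (k * isosceles_dist j t) ^ 2) by ring.
  apply Rmult_le_compat_l; [apply pow2_ge_0|].
  apply pow_incr; split; [|assumption].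
  apply Rmult_le_pos; [|apply isosceles_dist_nonneg]; assumption.
Qed.

Lemma affine_compare (i j : nat) (k d r p : R) :
  i <> 6%nat -> j <> 6%nat -> 0 <= k ->
  (forall t, -1 < t < 1 -> k * isosceles_dist j t <= isosceles_dist i t) ->
  0 <= d < 1 -> r = (1 - d ^ 2) / 2 ->
  isosceles_p d <= p <= isosceles_p (- d) ->
  k ^ 2 * sqdist8 j r p <= sqdist8 i r p.
Proof.
  intros hi hj hk h hd hr hp.
  assert (hlo : k ^ 2 * sqdist8 j r (isosceles_p d) <=
                sqdist8 i r (isosceles_p d))
    by (rewrite hr; apply isosceles_compare; [lra | lra | apply h; lra]).
  assert (hhi : k ^ 2 * sqdist8 j r (isosceles_p (- d)) <=
                sqdist8 i r (isosceles_p (- d)))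
    by (replace r with ((1 - (- d) ^ 2) / 2) by (rewrite hr; field);
        apply isosceles_compare; [lra | lra | apply h; lra]).
  pose proof (isosceles_p_gap d) as gap.
  (* For [d = 0] the triangle is equilateral and the interval for [p] is a point, so the weight [w]
     below would divide by zero. *)
  destruct (Req_dec d 0) as [d0 | d0].
  { subst d. replace p with (isosceles_p 0); [assumption|].
    rewrite Ropp_0 in hp; lra. }
  assert (0 < d ^ 3) by (apply pow_lt; lra).
  set (w := (p - isosceles_p d) / (isosceles_p (- d) - isosceles_p d)).
  assert (hw : 0 <= w <= 1).
  { unfold w; split.
    - apply Rmult_le_pos; [lra | left; apply Rinv_0_lt_compat; lra].
    - apply Rmult_le_reg_r with (isosceles_p (- d) - isosceles_p d); [lra|].
      unfold Rdiv; rewrite Rmult_assoc, Rinv_l; lra. }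
  replace p with ((1 - w) * isosceles_p d + w * isosceles_p (- d))
    by (unfold w; field; lra).
  rewrite !sqdist8_affine by assumption. nra.
Qed.

(** * The symmedian point: slope in q *)

(* q = (a^2 + b^2 + c^2) / (2 R^2); D(8,6)^2 is concave as a function of q. *)
Definition sq_symmedian (r q : R) : R :=
  q - 8 * r + 8 * r ^ 2 - (44 * r ^ 2 - 8 * r ^ 3 - 4 * r ^ 4) * / q
  - (48 * r ^ 3 + 12 * r ^ 4) * (/ q) ^ 2.

Lemma sqdist8_6 (r p : R) : sqdist8 6 r p = sq_symmedian r (p - r ^ 2 - 4 * r).
Proof.
  unfold sqdist8, sq_symmedian, Rdiv; cbv zeta. rewrite pow_inv. reflexivity.
Qed.

(** By concavity a chord is at least as steep as the derivative at [q2]. The cubic term of that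
    derivative is dropped, and 39 is the value of [44 - 8 * r - 4 * r ^ 2] at [r = 1 / 2], its
    minimum. *)
Lemma sq_symmedian_incr (r q1 q2 : R) :
  0 < r <= 1 / 2 -> 0 < q1 <= q2 ->
  (q2 - q1) * (1 + 39 * r ^ 2 * (/ q2) ^ 2) <=
  sq_symmedian r q2 - sq_symmedian r q1.
Proof.
  intros hr hq.
  assert (hu : 0 < / q2 <= / q1)
    by (split; [apply Rinv_0_lt_compat | apply Rinv_le_contravar]; lra).
  assert (h : / q1 - / q2 = (q2 - q1) * (/ q1 * / q2)) by (field; split; lra).
  unfold sq_symmedian. set (u1 := / q1) in *; set (u2 := / q2) in *.
  assert (0 <= (48 * r ^ 3 + 12 * r ^ 4) * (u1 ^ 2 - u2 ^ 2)).
  { apply Rmult_le_pos; [|nra].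
    replace (48 * r ^ 3 + 12 * r ^ 4) with (r ^ 3 * (48 + 12 * r)) by ring.
    apply Rmult_le_pos; [apply pow_le|]; lra. }
  assert (39 * r ^ 2 <= 44 * r ^ 2 - 8 * r ^ 3 - 4 * r ^ 4).
  { replace (44 * r ^ 2 - 8 * r ^ 3 - 4 * r ^ 4)
      with (r ^ 2 * (44 - 8 * r - 4 * r ^ 2)) by ring.
    rewrite (Rmult_comm 39). apply Rmult_le_compat_l; nra. }
  assert ((q2 - q1) * u2 ^ 2 <= u1 - u2)
    by (rewrite h; apply Rmult_le_compat_l; [|simpl]; nra).
  assert (0 <= (q2 - q1) * u2 ^ 2) by (apply Rmult_le_pos; nra).
  assert (39 * r ^ 2 * ((q2 - q1) * u2 ^ 2) <=
          (44 * r ^ 2 - 8 * r ^ 3 - 4 * r ^ 4) * (u1 - u2))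
    by (apply Rmult_le_compat; nra).
  lra.
Qed.

Lemma sq_symmedian_slope_ge1 (r q1 q2 : R) :
  0 < r <= 1 / 2 -> 0 < q1 <= q2 ->
  q2 - q1 <= sq_symmedian r q2 - sq_symmedian r q1.
Proof.
  intros hr hq. pose proof (sq_symmedian_incr r q1 q2 hr hq).
  assert (0 <= (q2 - q1) * (39 * r ^ 2 * (/ q2) ^ 2)).
  { apply Rmult_le_pos; [lra|]. apply Rmult_le_pos; [nra | apply pow2_ge_0]. }
  lra.
Qed.

(** A concave function lies below its tangent; the last factor is the exact derivative at [q1],
    written in powers of [r / q1]. *)
Lemma sq_symmedian_tangent (r q1 q2 : R) :
  0 < r <= 1 / 2 -> 0 < q1 <= q2 ->
  sq_symmedian r q2 - sq_symmedian r q1 <=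
  (q2 - q1) * (1 + (44 - 8 * r - 4 * r ^ 2) * (r * / q1) ^ 2
               + (96 + 24 * r) * (r * / q1) ^ 3).
Proof.
  intros hr hq.
  assert (hu : 0 < / q2 <= / q1)
    by (split; [apply Rinv_0_lt_compat | apply Rinv_le_contravar]; lra).
  assert (h : / q1 - / q2 = (q2 - q1) * (/ q1 * / q2)) by (field; split; lra).
  unfold sq_symmedian. set (u1 := / q1) in *; set (u2 := / q2) in *.
  assert (h1 : u1 - u2 <= (q2 - q1) * u1 ^ 2)
    by (rewrite h; apply Rmult_le_compat_l; [|simpl]; nra).
  assert (h2 : u1 ^ 2 - u2 ^ 2 <= 2 * (q2 - q1) * u1 ^ 3).
  { replace (u1 ^ 2 - u2 ^ 2) with ((u1 - u2) * (u1 + u2)) by ring.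
    replace (2 * (q2 - q1) * u1 ^ 3)
      with ((q2 - q1) * u1 ^ 2 * (2 * u1)) by ring.
    apply Rmult_le_compat; lra. }
  assert (0 <= r ^ 2 * (44 - 8 * r - 4 * r ^ 2)) by (apply Rmult_le_pos; nra).
  assert (0 <= r ^ 3 * (48 + 12 * r))
    by (apply Rmult_le_pos; [apply pow_le|]; lra).
  assert (r ^ 2 * (44 - 8 * r - 4 * r ^ 2) * (u1 - u2) <=
          r ^ 2 * (44 - 8 * r - 4 * r ^ 2) * ((q2 - q1) * u1 ^ 2))
    by (apply Rmult_le_compat_l; assumption).
  assert (r ^ 3 * (48 + 12 * r) * (u1 ^ 2 - u2 ^ 2) <=
          r ^ 3 * (48 + 12 * r) * (2 * (q2 - q1) * u1 ^ 3))
    by (apply Rmult_le_compat_l; assumption).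
  nra.
Qed.

Definition isosceles_q (t : R) : R :=
  (3 + t) * (1 - t) * (t ^ 2 + 2 * t + 3) / 2.

Lemma isosceles_q_p (t : R) :
  isosceles_p t - ((1 - t ^ 2) / 2) ^ 2 - 4 * ((1 - t ^ 2) / 2) = isosceles_q t.
Proof. unfold isosceles_p, isosceles_q; field. Qed.

Lemma isosceles_q_pos (t : R) : -1 < t < 1 -> 0 < isosceles_q t.
Proof.
  intros; unfold isosceles_q.
  repeat apply Rmult_lt_0_compat; nra.
Qed.

Lemma isosceles_q_bounds (d r p : R) :
  0 <= d < 1 -> r = (1 - d ^ 2) / 2 ->
  isosceles_p d <= p <= isosceles_p (- d) ->
  0 < r <= 1 / 2 /\ 0 < isosceles_q d /\
  isosceles_p d - r ^ 2 - 4 * r = isosceles_q d /\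
  isosceles_p (- d) - r ^ 2 - 4 * r = isosceles_q (- d) /\
  isosceles_q d <= p - r ^ 2 - 4 * r <= isosceles_q (- d).
Proof.
  intros hd hr hp.
  assert (h1 : isosceles_p d - r ^ 2 - 4 * r = isosceles_q d)
    by (rewrite hr; apply isosceles_q_p).
  assert (h2 : isosceles_p (- d) - r ^ 2 - 4 * r = isosceles_q (- d))
    by (rewrite hr; replace (d ^ 2) with ((- d) ^ 2) by ring;
        apply isosceles_q_p).
  repeat split; try assumption; try (rewrite hr; nra); try lra.
  apply isosceles_q_pos; lra.
Qed.

Lemma isosceles_compare_neg (i j : nat) (k d : R) :
  0 <= d < 1 -> 0 <= k ->
  k * isosceles_dist j (- d) <= isosceles_dist i (- d) ->
  k ^ 2 * sqdist8 j ((1 - d ^ 2) / 2) (isosceles_p (- d)) <=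
  sqdist8 i ((1 - d ^ 2) / 2) (isosceles_p (- d)).
Proof.
  intros hd hk h. replace (d ^ 2) with ((- d) ^ 2) by ring.
  apply isosceles_compare; [lra | assumption | assumption].
Qed.


(** * Inequalities with the symmedian point *)

(** D(8,1)^2 has slope exactly 1 in p and D(8,6)^2 at least 1, so the left endpoint decides. *)
Lemma sqdist8_1_le_6 (d r p : R) :
  0 <= d < 1 -> r = (1 - d ^ 2) / 2 ->
  isosceles_p d <= p <= isosceles_p (- d) ->
  1 ^ 2 * sqdist8 1 r p <= sqdist8 6 r p.
Proof.
  intros hd hr hp.
  destruct (isosceles_q_bounds d r p hd hr hp) as (hr2 & hq & h1 & h2 & hqb).
  assert (iso : 1 ^ 2 * sqdist8 1 r (isosceles_p d) <=
                sqdist8 6 r (isosceles_p d)).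
  { rewrite hr; apply isosceles_compare; [lra | lra | unfold isosceles_dist].
    apply Rmult_le_reg_r with (d ^ 2 + 2 * d + 3); [nra|].
    unfold Rdiv; rewrite (Rmult_assoc _ (/ _)), Rinv_l by nra. nra. }
  rewrite sqdist8_6 in *. rewrite h1 in iso.
  pose proof (sq_symmedian_slope_ge1 r _ _ hr2 (conj hq (proj1 hqb))).
  unfold sqdist8 in *; lra.
Qed.

(** D(8,4) does not depend on p while D(8,6) increases, so the right endpoint decides. *)
Lemma sqdist8_6_le_4 (d r p : R) :
  0 <= d < 1 -> r = (1 - d ^ 2) / 2 ->
  isosceles_p d <= p <= isosceles_p (- d) ->
  1 ^ 2 * sqdist8 6 r p <= sqdist8 4 r p.
Proof.
  intros hd hr hp.
  destruct (isosceles_q_bounds d r p hd hr hp) as (hr2 & hq & h1 & h2 & hqb).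
  assert (iso : 1 ^ 2 * sqdist8 6 r (isosceles_p (- d)) <=
                sqdist8 4 r (isosceles_p (- d))).
  { rewrite hr; apply isosceles_compare_neg;
      [lra | lra | unfold isosceles_dist].
    apply Rmult_le_reg_r with ((- d) ^ 2 + 2 * (- d) + 3); [nra|].
    match goal with |- ?l <= _ =>
      replace l with ((1 + d) * (d ^ 2 - 3 * d + 4)) by (field; nra) end.
    (* This product is exactly the difference of the two sides. *)
    assert (0 <= (1 - d) ^ 2 * (2 - d)) by (apply Rmult_le_pos; nra). nra. }
  rewrite sqdist8_6 in *. rewrite h2 in iso.
  assert (hq2 : 0 < p - r ^ 2 - 4 * r <= isosceles_q (- d)) by lra.
  pose proof (sq_symmedian_slope_ge1 r _ _ hr2 hq2).
  unfold sqdist8 in *; lra.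
Qed.

Lemma sqdist8_7_le_6 (d r p : R) :
  0 <= d < 1 -> r = (1 - d ^ 2) / 2 ->
  isosceles_p d <= p <= isosceles_p (- d) ->
  (2 / 3) ^ 2 * sqdist8 7 r p <= sqdist8 6 r p.
Proof.
  intros hd hr hp.
  destruct (isosceles_q_bounds d r p hd hr hp) as (hr2 & hq & h1 & h2 & hqb).
  assert (iso : (2 / 3) ^ 2 * sqdist8 7 r (isosceles_p d) <=
                sqdist8 6 r (isosceles_p d)).
  { rewrite hr; apply isosceles_compare; [lra | lra | unfold isosceles_dist].
    apply Rmult_le_reg_r with ((d ^ 2 + 2 * d + 3) * (3 - d)); [nra|].
    replace (2 / 3 * (4 * (1 - d) / (3 - d)) * ((d ^ 2 + 2 * d + 3) * (3 - d)))
      with (8 / 3 * (1 - d) * (d ^ 2 + 2 * d + 3)) by (field; lra).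
    replace ((1 - d) * (d ^ 2 + 3 * d + 4) / (d ^ 2 + 2 * d + 3) *
             ((d ^ 2 + 2 * d + 3) * (3 - d)))
      with ((1 - d) * ((d ^ 2 + 3 * d + 4) * (3 - d))) by (field; nra).
    rewrite (Rmult_comm (8 / 3)), Rmult_assoc.
    apply Rmult_le_compat_l; [lra|]. nra. }
  rewrite sqdist8_6 in *. rewrite h1 in iso.
  pose proof (sq_symmedian_slope_ge1 r _ _ hr2 (conj hq (proj1 hqb))).
  assert (slope : sqdist8 7 r p - sqdist8 7 r (isosceles_p d) =
                  16 * (1 + r) / (4 + r) ^ 2 * (p - isosceles_p d))
    by (unfold sqdist8; field; lra).
  (* After scaling by (2/3)^2 = 4/9, the slope of D(8,7)^2 is then at most 1, hence at most that of
     D(8,6)^2. *)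
  assert (16 * (1 + r) / (4 + r) ^ 2 <= 9 / 4).
  { apply Rmult_le_reg_r with ((4 + r) ^ 2); [nra|].
    unfold Rdiv; rewrite Rmult_assoc, Rinv_l by nra. nra. }
  nra.
Qed.

(** The left endpoint decides here too: D(8,1)^2 has slope 1, whereas that of [k ^ 2] times D(8,6)^2
    is at most 0.55 * 1.7 < 1. *)
Lemma sqdist8_6_le_1 (d r p k : R) :
  0 <= d < 1 -> r = (1 - d ^ 2) / 2 ->
  isosceles_p d <= p <= isosceles_p (- d) ->
  k = 2 / 7 * (4 - sqrt 2) ->
  k ^ 2 * sqdist8 6 r p <= sqdist8 1 r p.
Proof.
  intros hd hr hp hk.
  pose proof (sqrt_pos 2) as s0. pose proof (pow2_sqrt 2 ltac:(lra)) as s2.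
  revert s0 s2 hk; generalize (sqrt 2); intros s s0 s2 hk.
  assert (hs : 1.41 < s < 1.42) by (split; nra).
  destruct (isosceles_q_bounds d r p hd hr hp) as (hr2 & hq & h1 & h2 & hqb).
  assert (iso : k ^ 2 * sqdist8 6 r (isosceles_p d) <=
                sqdist8 1 r (isosceles_p d)).
  { rewrite hr; apply isosceles_compare; [lra | lra | unfold isosceles_dist].
    apply Rmult_le_reg_r with (d ^ 2 + 2 * d + 3); [nra|].
    replace (k * ((1 - d) * (d ^ 2 + 3 * d + 4) / (d ^ 2 + 2 * d + 3)) *
             (d ^ 2 + 2 * d + 3))
      with ((1 - d) * (k * (d ^ 2 + 3 * d + 4))) by (field; nra).
    apply Rmult_le_compat_l; [lra|].
    (* equality at d = sqrt 2 - 1 *)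
    assert (h : 7 * (d ^ 2 + 2 * d + 3 - k * (d ^ 2 + 3 * d + 4)) =
            (2 * s - 1) * (d - (s - 1)) ^ 2 + (s ^ 2 - 2) * (4 * d - 2 * s + 5))
      by (rewrite hk; field).
    rewrite s2 in h.
    assert (0 <= (2 * s - 1) * (d - (s - 1)) ^ 2)
      by (apply Rmult_le_pos; [lra | apply pow2_ge_0]).
    lra. }
  rewrite sqdist8_6 in *. rewrite h1 in iso.
  pose proof (sq_symmedian_tangent r _ _ hr2 (conj hq (proj1 hqb))) as tan.
  (* The bound 1/9 is attained by the equilateral triangle; it makes the tangent slope at most 1 +
     44/81 + 108/729 < 1.7. *)
  assert (hm : 0 <= r * / isosceles_q d <= 1 / 9).
  { split; [apply Rmult_le_pos; [|left; apply Rinv_0_lt_compat]; lra|].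
    apply Rmult_le_reg_r with (isosceles_q d); [lra|].
    rewrite Rmult_assoc, Rinv_l by lra.
    replace (1 / 9 * isosceles_q d)
      with (r + (1 - d) * (5 * d ^ 2 + d ^ 3) / 18)
      by (rewrite hr; unfold isosceles_q; field).
    assert (0 <= (1 - d) * (5 * d ^ 2 + d ^ 3)); [|lra].
    apply Rmult_le_pos; [lra|].
    pose proof (pow_le d 3 (proj1 hd)). nra. }
  set (m := r * / isosceles_q d) in *.
  assert (m ^ 2 <= 1 / 81) by nra.
  assert (m ^ 3 <= 1 / 729) by (simpl; nra).
  assert (0 <= m ^ 3) by (apply pow_le; lra).
  assert ((44 - 8 * r - 4 * r ^ 2) * m ^ 2 <= 44 / 81)
    by (assert (0 <= m ^ 2) by nra; nra).
  assert ((96 + 24 * r) * m ^ 3 <= 108 / 729) by nra.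
  assert (k ^ 2 <= 0.55) by (rewrite hk; nra).
  assert (0 <= k ^ 2) by apply pow2_ge_0.
  assert (sq_symmedian r (p - r ^ 2 - 4 * r) - sq_symmedian r (isosceles_q d)
          <= (p - isosceles_p d) * (1.7)).
  { eapply Rle_trans; [exact tan|].
    replace (p - r ^ 2 - 4 * r - isosceles_q d) with (p - isosceles_p d) by lra.
    apply Rmult_le_compat_l; lra. }
  assert (k ^ 2 * (sq_symmedian r (p - r ^ 2 - 4 * r)
                   - sq_symmedian r (isosceles_q d)) <=
          0.55 * ((p - isosceles_p d) * 1.7)).
  { apply Rle_trans with (k ^ 2 * ((p - isosceles_p d) * 1.7)).
    - apply Rmult_le_compat_l; assumption.
    - apply Rmult_le_compat_r; lra. }
  unfold sqdist8 in *; lra.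
Qed.

(* The left side bounds the slope of D(8,6)^2 in q, the fraction with (4 + r)^2
   is that of D(8,7)^2. The correction term is needed only near d = 0. *)
Lemma symmedian_gergonne_slope (d r m : R) :
  0 <= d <= 1 -> r = (1 - d ^ 2) / 2 ->
  m = (1 + d) / ((3 + d) * (d ^ 2 + 2 * d + 3)) ->
  1 + (44 - 8 * r - 4 * r ^ 2) * m ^ 2 + (96 + 24 * r) * m ^ 3 <=
  49 / 36 * (16 * (1 + r) / (4 + r) ^ 2) + r * (1 - d) ^ 2 / 25.
Proof.
  intros hd hr hm.
  assert (0 <= 49 / 36 * (16 * (1 + r) / (4 + r) ^ 2) + r * (1 - d) ^ 2 / 25 -
    (1 + (44 - 8 * r - 4 * r ^ 2) * m ^ 2 + (96 + 24 * r) * m ^ 3)); [|lra].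
  match goal with |- 0 <= ?e => replace e with
    (* Bernstein form of the numerator *)
    ((
       10449 * (1 - d) ^ 15 +
              63018 * d * (1 - d) ^ 14 +
              1147770 * d ^ 2 * (1 - d) ^ 13 +
              15658452 * d ^ 3 * (1 - d) ^ 12 +
              106954836 * d ^ 4 * (1 - d) ^ 11 +
              438450792 * d ^ 5 * (1 - d) ^ 10 +
              1199069800 * d ^ 6 * (1 - d) ^ 9 +
              2312629344 * d ^ 7 * (1 - d) ^ 8 +
              3234279528 * d ^ 8 * (1 - d) ^ 7 +
              3310831904 * d ^ 9 * (1 - d) ^ 6 +
              2465129856 * d ^ 10 * (1 - d) ^ 5 +
              1303030848 * d ^ 11 * (1 - d) ^ 4 +
              464388928 * d ^ 12 * (1 - d) ^ 3 +
              100224000 * d ^ 13 * (1 - d) ^ 2 +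
              9907200 * d ^ 14 * (1 - d)) /
     (450 * (3 - d) ^ 2 * (3 + d) ^ 3 * (d ^ 2 + 2 * d + 3) ^ 3)) end.
  2:{ rewrite hm, hr; field; repeat split; nra. }
  apply Rmult_le_pos.
  - repeat apply Rplus_le_le_0_compat;
      repeat apply Rmult_le_pos; try apply pow_le; lra.
  - left; apply Rinv_0_lt_compat.
    repeat apply Rmult_lt_0_compat; try apply pow_lt; nra.
Qed.

(** Starting from the left endpoint, the tangent estimate shows that D(8,6)^2 outgrows 49/36 of
    D(8,7)^2 by only a small excess, and the inequality has room for it at that endpoint. *)
Lemma sqdist8_6_le_7 (d r p : R) :
  0 <= d < 1 -> r = (1 - d ^ 2) / 2 ->
  isosceles_p d <= p <= isosceles_p (- d) ->
  (6 / 7) ^ 2 * sqdist8 6 r p <= sqdist8 7 r p.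
Proof.
  intros hd hr hp.
  destruct (isosceles_q_bounds d r p hd hr hp) as (hr2 & hq & h1 & h2 & hqb).
  (* The gap absorbs the excess slope r (1 - d)^2 / 25 of D(8,6)^2 over an
     interval of length 4 d^3. *)
  assert (iso : sqdist8 6 r (isosceles_p d) + r * (1 - d) ^ 2 / 25 * (4 * d ^ 3) <=
                49 / 36 * sqdist8 7 r (isosceles_p d)).
  { rewrite hr, !sqdist8_isosceles by lra.
    (* Both distances are measured against [1 - d]. The room comes from 1.36^2 < 1.85 and 1.85 + 0.5
       < 49/36 * 16/9. *)
    assert (h6 : 0 <= isosceles_dist 6 d <= 1.36 * (1 - d)).
    { split; [apply isosceles_dist_nonneg; lra|]. unfold isosceles_dist.
      apply Rmult_le_reg_r with (d ^ 2 + 2 * d + 3); [nra|].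
      unfold Rdiv; rewrite (Rmult_assoc _ (/ _)), Rinv_l by nra.
      replace ((1 - d) * (d ^ 2 + 3 * d + 4) * 1)
        with ((1 - d) * (d ^ 2 + 3 * d + 4)) by ring.
      rewrite (Rmult_comm 1.36), Rmult_assoc.
      apply Rmult_le_compat_l; nra. }
    assert (h7 : 4 / 3 * (1 - d) <= isosceles_dist 7 d).
    { unfold isosceles_dist.
      apply Rmult_le_reg_r with (3 - d); [lra|].
      replace (4 * (1 - d) / (3 - d) * (3 - d)) with (4 * (1 - d))
        by (field; lra).
      nra. }
    pose proof (pow2_ge_0 (1 - d)).
    assert (isosceles_dist 6 d ^ 2 <= 1.85 * (1 - d) ^ 2) by nra.
    assert (16 / 9 * (1 - d) ^ 2 <= isosceles_dist 7 d ^ 2) by nra.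
    assert ((1 - d ^ 2) / 2 / 25 * (4 * d) <= 0.5) by nra.
    assert ((1 - d) ^ 2 * ((1 - d ^ 2) / 2 / 25 * (4 * d)) <=
            (1 - d) ^ 2 * (0.5))
      by (apply Rmult_le_compat_l; [apply pow2_ge_0 | assumption]).
    assert (d ^ 2 * (isosceles_dist 6 d ^ 2 +
                     (1 - d) ^ 2 * ((1 - d ^ 2) / 2 / 25 * (4 * d))) <=
            d ^ 2 * (49 / 36 * isosceles_dist 7 d ^ 2))
      by (apply Rmult_le_compat_l; [apply pow2_ge_0 | lra]).
    lra. }
  rewrite sqdist8_6 in *. rewrite h1 in iso.
  pose proof (sq_symmedian_tangent r _ _ hr2 (conj hq (proj1 hqb))) as tan.
  assert (hm : r * / isosceles_q d =
               (1 + d) / ((3 + d) * (d ^ 2 + 2 * d + 3)))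
    by (rewrite hr; unfold isosceles_q; field; repeat split; nra).
  pose proof (symmedian_gergonne_slope d r _ ltac:(lra) hr hm) as hs.
  assert (slope : sqdist8 7 r p - sqdist8 7 r (isosceles_p d) =
                  16 * (1 + r) / (4 + r) ^ 2 * (p - isosceles_p d))
    by (unfold sqdist8; field; lra).
  set (S := 16 * (1 + r) / (4 + r) ^ 2) in *.
  replace (p - r ^ 2 - 4 * r - isosceles_q d)
    with (p - isosceles_p d) in tan by lra.
  assert (sq_symmedian r (p - r ^ 2 - 4 * r) - sq_symmedian r (isosceles_q d)
          <= (p - isosceles_p d) * (49 / 36 * S + r * (1 - d) ^ 2 / 25))
    by (eapply Rle_trans; [exact tan | apply Rmult_le_compat_l; lra]).
  assert (r * (1 - d) ^ 2 / 25 * (p - isosceles_p d) <=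
          r * (1 - d) ^ 2 / 25 * (4 * d ^ 3)).
  { rewrite <- isosceles_p_gap. apply Rmult_le_compat_l; [|lra].
    assert (0 <= r * (1 - d) ^ 2); [|lra].
    apply Rmult_le_pos; [lra | apply pow2_ge_0]. }
  lra.
Qed.

Lemma sqdist8_6_le_5 (d r p C : R) :
  0 <= d < 1 -> r = (1 - d ^ 2) / 2 ->
  isosceles_p d <= p <= isosceles_p (- d) ->
  0.6817 <= C <= 0.68171 ->
  (forall t, -1 < t < 1 -> C * isosceles_dist 6 t <= isosceles_dist 5 t) ->
  C ^ 2 * sqdist8 6 r p <= sqdist8 5 r p.
Proof.
  intros hd hr hp hC hiso.
  destruct (isosceles_q_bounds d r p hd hr hp) as (hr2 & hq & h1 & h2 & hqb).
  assert (hC2 : 0.4647 <= C ^ 2 <= 0.46473) by (split; nra).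
  assert (hq2 : 0 < p - r ^ 2 - 4 * r <= isosceles_q (- d)) by lra.
  assert (slope : sqdist8 5 r (isosceles_p (- d)) - sqdist8 5 r p =
                  (isosceles_p (- d) - p) / 2) by (unfold sqdist8; field).
  rewrite sqdist8_6.
  (* For d <= 0.8, D(8,5)^2 - C^2 D(8,6)^2 decreases in q; for larger d it may
     increase, but at most with slope 1 / 2 - C^2 <= 0.0353. *)
  destruct (Rle_or_lt d 0.8) as [hd8 | hd8].
  - assert (iso : C ^ 2 * sqdist8 6 r (isosceles_p (- d)) <=
                  sqdist8 5 r (isosceles_p (- d)))
      by (rewrite hr; apply isosceles_compare_neg;
          [lra | lra | apply hiso; lra]).
    rewrite sqdist8_6, h2 in iso.
    pose proof (sq_symmedian_incr r _ _ hr2 hq2) as incr.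
    (* This constant gives slope at least 1.076 for D(8,6)^2, and 0.4647 * 1.076 exceeds 1/2, the
       slope of D(8,5)^2. *)
    assert (hm : 0.04415 <= r * / isosceles_q (- d)).
    { apply Rmult_le_reg_r with (isosceles_q (- d)); [lra|].
      rewrite Rmult_assoc, Rinv_l by lra.
      replace (isosceles_q (- d))
        with ((1 + d) / 2 * ((3 - d) * (d ^ 2 - 2 * d + 3)))
        by (unfold isosceles_q; field).
      replace (r * 1) with ((1 + d) / 2 * (1 - d)) by (rewrite hr; field).
      rewrite <- Rmult_assoc, (Rmult_comm 0.04415), Rmult_assoc.
      apply Rmult_le_compat_l; [lra|].
      (* Nonnegativity of this product says that [d ^ 3] lies above its tangent at 0.8. *)
      assert (0 <= (d - 0.8) ^ 2 * (d + 1.6))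
        by (apply Rmult_le_pos; [apply pow2_ge_0 | lra]).
      nra. }
    assert (1.076 <= 1 + 39 * r ^ 2 * (/ isosceles_q (- d)) ^ 2).
    { replace (39 * r ^ 2 * (/ isosceles_q (- d)) ^ 2)
        with (39 * (r * / isosceles_q (- d)) ^ 2) by ring. nra. }
    assert ((isosceles_p (- d) - p) * 1.076 <=
            sq_symmedian r (isosceles_q (- d))
            - sq_symmedian r (p - r ^ 2 - 4 * r)).
    { eapply Rle_trans; [|exact incr].
      replace (isosceles_q (- d) - (p - r ^ 2 - 4 * r))
        with (isosceles_p (- d) - p) by lra.
      apply Rmult_le_compat_l; lra. }
    assert (0.4647 * ((isosceles_p (- d) - p) * 1.076) <=
            C ^ 2 * (sq_symmedian r (isosceles_q (- d))
                     - sq_symmedian r (p - r ^ 2 - 4 * r)))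
      by (apply Rmult_le_compat; lra).
    lra.
  - assert (iso : C ^ 2 * sqdist8 6 r (isosceles_p (- d)) + 0.0353 * (4 * d ^ 3) <=
                  sqdist8 5 r (isosceles_p (- d))).
    { replace r with ((1 - (- d) ^ 2) / 2) by (rewrite hr; field).
      rewrite !sqdist8_isosceles by lra.
      assert (h6 : 0 <= isosceles_dist 6 (- d) <= 1.908 + 0.1 * d).
      { split; [apply isosceles_dist_nonneg; lra|]. unfold isosceles_dist.
        apply Rmult_le_reg_r with ((- d) ^ 2 + 2 * (- d) + 3); [nra|].
        unfold Rdiv; rewrite (Rmult_assoc _ (/ _)), Rinv_l by nra.
        (* The affine bound [1.908 + 0.1 * d] nearly touches the curve near [d = 0.91]; this product
           approximates the cleared difference from below. *)
        assert (0 <= (d - 0.91) ^ 2 * (2.067 - 0.9 * d))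
          by (apply Rmult_le_pos; [apply pow2_ge_0 | lra]).
        nra. }
      assert (isosceles_dist 6 (- d) ^ 2 <= (1.908 + 0.1 * d) ^ 2)
        by (apply pow_incr; assumption).
      assert (C ^ 2 * isosceles_dist 6 (- d) ^ 2 <=
              0.46473 * (1.908 + 0.1 * d) ^ 2)
        by (apply Rmult_le_compat; try apply pow2_ge_0; lra).
      assert (0.46473 * (1.908 + 0.1 * d) ^ 2 + 0.0353 * (4 * d) <=
              isosceles_dist 5 (- d) ^ 2) by (unfold isosceles_dist; nra).
      assert (d ^ 2 * (C ^ 2 * isosceles_dist 6 (- d) ^ 2 + 0.0353 * (4 * d)) <=
              d ^ 2 * isosceles_dist 5 (- d) ^ 2)
        by (apply Rmult_le_compat_l; [apply pow2_ge_0 | lra]).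
      lra. }
    rewrite sqdist8_6, h2 in iso.
    pose proof (sq_symmedian_slope_ge1 r _ _ hr2 hq2) as incr.
    assert (0.4647 * (isosceles_p (- d) - p) <=
            C ^ 2 * (sq_symmedian r (isosceles_q (- d))
                     - sq_symmedian r (p - r ^ 2 - 4 * r)))
      by (apply Rmult_le_compat; lra).
    rewrite <- isosceles_p_gap in iso. lra.
Qed.

(** * The constant C_8 *)

(** This excludes smaller positive roots: after dividing out [C - y], the cofactor is a cubic in [y]
    whose coefficients are bounded numerically, and a cubic with double root 0.43 certifies its
    positivity. *)
Lemma quartic8_pos (C y : R) :
  0.6817 <= C <= 0.68171 -> quartic8 C = 0 -> 0 < y -> y < C -> 0 < quartic8 y.
Proof.
  intros hC h0 hy hyC.
  assert (h : quartic8 y = (C - y) *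
    (758 - 1924 * (y + C) + 2184 * (y ^ 2 + y * C + C ^ 2)
     - 896 * (y ^ 3 + y ^ 2 * C + y * C ^ 2 + C ^ 3)))
    by (rewrite <- (Rminus_0_r (quartic8 y)), <- h0; unfold quartic8; ring).
  rewrite h; apply Rmult_lt_0_compat; [lra|].
  assert (1573.1 <= 2184 - 896 * C) by lra.
  assert (-852 <= - 1924 + 2184 * C - 896 * C ^ 2) by nra.
  assert (177 <= 758 - 1924 * C + 2184 * C ^ 2 - 896 * C ^ 3) by nra.
  assert (0 <= (y - 0.43) ^ 2 * (802.5 - 896 * y))
    by (apply Rmult_le_pos; [apply pow2_ge_0 | lra]).
  nra.
Qed.

(** Up to a factor 2, this quartic is the numerator of the derivative of (6 + t - t^3) / (4 - t - 2
    t^2 - t^3), so [s] is the minimizer behind C_8. The narrow interval yields its ten decimals. *)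
Lemma critical_point :
  exists s : R, s ^ 4 + 2 * s ^ 3 + 4 * s ^ 2 + 12 * s + 5 = 0 /\
    -0.47928587463 <= s <= -0.47928587461.
Proof.
  set (f := fun s : R => s ^ 4 + 2 * s ^ 3 + 4 * s ^ 2 + 12 * s + 5).
  destruct (IVT f (-0.47928587463) (-0.47928587461)) as [s [hs h]];
    unfold f; try lra.
  - intro x; apply derivable_continuous_pt; unfold f; reg.
  - exists s; split; assumption.
Qed.

(** The quotient of [isosceles_dist 5 t] by [isosceles_dist 6 t], with products expanded. *)
Definition symmedian_nine_point_ratio (t : R) : R :=
  (6 + t - t ^ 3) / (2 * (4 - t - 2 * t ^ 2 - t ^ 3)).

Lemma C8_spec :
  exists C : R, smallest_positive_root quartic8 C /\
    Rabs (C - 6817039304 / 10 ^ 10) <= 5 / 10 ^ 11 /\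
    0.6817 <= C <= 0.68171 /\
    forall t, -1 < t < 1 -> C * isosceles_dist 6 t <= isosceles_dist 5 t.
Proof.
  destruct critical_point as (s & hs & hsb).
  exists (symmedian_nine_point_ratio s).
  assert (hd : 0 < 4 - s - 2 * s ^ 2 - s ^ 3) by nra.
  assert (bound : - (5 / 10 ^ 11) <=
    symmedian_nine_point_ratio s - 6817039304 / 10 ^ 10 <= 5 / 10 ^ 11).
  { unfold symmedian_nine_point_ratio; split;
      apply Rmult_le_reg_r with (2 * (4 - s - 2 * s ^ 2 - s ^ 3));
      try lra.
    all: replace (((6 + s - s ^ 3) / (2 * (4 - s - 2 * s ^ 2 - s ^ 3))
                   - 6817039304 / 10 ^ 10) * (2 * (4 - s - 2 * s ^ 2 - s ^ 3)))
      with (6 + s - s ^ 3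
            - 6817039304 / 10 ^ 10 * (2 * (4 - s - 2 * s ^ 2 - s ^ 3)))
      by (field; lra).
    all: nra. }
  assert (0.6817 <= symmedian_nine_point_ratio s <= 0.68171) as hC
    by (split; lra).
  assert (root : quartic8 (symmedian_nine_point_ratio s) = 0).
  (* Substituting the ratio into [quartic8] gives a numerator divisible by the quartic that vanishes
     at [s]. *)
  { unfold quartic8, symmedian_nine_point_ratio.
    match goal with |- ?e = 0 => replace e with
      ((s ^ 4 + 2 * s ^ 3 + 4 * s ^ 2 + 12 * s + 5) *
       (96 * s ^ 8 + 960 * s ^ 7 + 2944 * s ^ 6 + 6912 * s ^ 5 + 14560 * s ^ 4
        + 17664 * s ^ 3 + 10752 * s ^ 2 - 2944 * s - 2560) /
       (2 * (4 - s - 2 * s ^ 2 - s ^ 3)) ^ 4) by (field; lra) end.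
    rewrite hs; field; lra. }
  split; [|split; [|split]].
  - split; [lra|]. split; [assumption|].
    intros y hy hy0. apply Rnot_lt_le; intro hlt.
    pose proof (quartic8_pos _ y hC root hy hlt). lra.
  - apply Rabs_le; assumption.
  - assumption.
  - intros t ht. unfold symmedian_nine_point_ratio, isosceles_dist.
    apply Rmult_le_reg_r with
      (2 * (4 - s - 2 * s ^ 2 - s ^ 3) * (t ^ 2 + 2 * t + 3)); [nra|].
    match goal with |- ?l <= ?r => replace l with
      ((6 + s - s ^ 3) * (4 - t - 2 * t ^ 2 - t ^ 3)) by (field; split; nra);
      replace r with ((6 + t - t ^ 3) * (4 - s - 2 * s ^ 2 - s ^ 3))
        by (field; nra) end.
    (* s is a double root of the difference *)
    assert (h : (6 + t - t ^ 3) * (4 - s - 2 * s ^ 2 - s ^ 3)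
                - (6 + s - s ^ 3) * (4 - t - 2 * t ^ 2 - t ^ 3) =
      (t - s) ^ 2 * (12 + 2 * t + 6 * s + 2 * s * t + 4 * s ^ 2
                     + 2 * s ^ 2 * t + 2 * s ^ 3)
      + 2 * (t - s) * (s ^ 4 + 2 * s ^ 3 + 4 * s ^ 2 + 12 * s + 5)) by ring.
    rewrite hs in h.
    assert (0 <= (t - s) ^ 2 * (12 + 2 * t + 6 * s + 2 * s * t + 4 * s ^ 2
                     + 2 * s ^ 2 * t + 2 * s ^ 3))
      by (apply Rmult_le_pos; [apply pow2_ge_0 | nra]).
    lra.
Qed.

(** * The ratio (5,7) and the collection of all bounds *)

(** With denominators cleared the difference is the square of [t + sqrt 2 - 1], so equality holds at
    [t = 1 - sqrt 2]. *)
Lemma gergonne_le_nine_point (t : R) :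
  -1 < t < 1 ->
  1 / 8 * (3 + 2 * sqrt 2) * isosceles_dist 7 t <= isosceles_dist 5 t.
Proof.
  intros ht. pose proof (pow2_sqrt 2 ltac:(lra)) as s2.
  unfold isosceles_dist.
  apply Rmult_le_reg_r with (2 * (3 - t)); [lra|].
  match goal with |- ?l <= ?r => replace l with
    ((3 + 2 * sqrt 2) * (1 - t)) by (field; lra);
    replace r with ((2 - t) * (3 - t)) by field end.
  assert (h : (2 - t) * (3 - t) - (3 + 2 * sqrt 2) * (1 - t) =
          (t + sqrt 2 - 1) ^ 2 - (sqrt 2 ^ 2 - 2)) by ring.
  pose proof (pow2_ge_0 (t + sqrt 2 - 1)). lra.
Qed.

Lemma scaled_sqrt_le (V A B k : R) :
  0 <= k -> 0 <= V -> k ^ 2 * A <= B -> k * sqrt (V * A) <= sqrt (V * B).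
Proof.
  intros hk hV h. rewrite <- (sqrt_pow2 k hk) at 1.
  rewrite <- sqrt_mult_alt by apply pow2_ge_0.
  apply sqrt_le_1_alt.
  replace (k ^ 2 * (V * A)) with (V * (k ^ 2 * A)) by ring.
  apply Rmult_le_compat_l; assumption.
Qed.

Lemma sqrt2_inv : / sqrt 2 = sqrt 2 / 2.
Proof.
  pose proof (pow2_sqrt 2 ltac:(lra)) as s2.
  assert (sqrt 2 <> 0) by (apply Rgt_not_eq, sqrt_lt_R0; lra).
  apply Rmult_eq_reg_l with (sqrt 2); [|assumption].
  rewrite Rinv_r by assumption. lra.
Qed.

Theorem theorem8 :
  exists C8 : R,
    smallest_positive_root quartic8 C8 /\
    Rabs (C8 - 6817039304 / 10 ^ 10) <= 5 / 10 ^ 11 /\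
    forall T : plane_triangle,
      D T 8 1 = 3 / 2 * D T 8 2 /\
      D T 8 1 <= 1 * D T 8 4 /\
      D T 8 1 <= 4 / 3 * D T 8 5 /\
      2 / 7 * (4 - sqrt 2) * D T 8 6 <= D T 8 1 <= 1 * D T 8 6 /\
      1 / 2 * D T 8 7 <= D T 8 1 <= 1 * D T 8 7 /\
      2 * D T 8 9 <= D T 8 1 /\
      D T 8 1 = 2 * D T 8 10 /\

      D T 8 2 <= 2 / 3 * D T 8 4 /\
      D T 8 2 <= 8 / 9 * D T 8 5 /\
      4 / 21 * (4 - sqrt 2) * D T 8 6 <= D T 8 2 <= 2 / 3 * D T 8 6 /\
      1 / 3 * D T 8 7 <= D T 8 2 <= 2 / 3 * D T 8 7 /\
      4 / 3 * D T 8 9 <= D T 8 2 /\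
      D T 8 2 = 4 / 3 * D T 8 10 /\

      D T 8 3 <= 1 / 2 * D T 8 4 /\
      D T 8 3 <= 2 * D T 8 5 /\
      4 / 3 * D T 8 5 <= D T 8 4 <= 4 * D T 8 5 /\
      1 * D T 8 6 <= D T 8 4 /\
      1 * D T 8 7 <= D T 8 4 /\
      2 * D T 8 9 <= D T 8 4 /\
      2 * D T 8 10 <= D T 8 4 /\

      C8 * D T 8 6 <= D T 8 5 /\
      1 / 8 * (3 + 2 * sqrt 2) * D T 8 7 <= D T 8 5 /\
      3 / 2 * D T 8 9 <= D T 8 5 /\
      3 / 2 * D T 8 10 <= D T 8 5 /\

      2 / 3 * D T 8 7 <= D T 8 6 <= 7 / 6 * D T 8 7 /\
      2 * D T 8 9 <= D T 8 6 /\
      2 * D T 8 10 <= D T 8 6 <= (2 + 1 / sqrt 2) * D T 8 10 /\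
      2 * D T 8 9 <= D T 8 7 /\
      2 * D T 8 10 <= D T 8 7 <= 4 * D T 8 10 /\
      D T 8 9 <= 1 * D T 8 10.
Proof.
  destruct C8_spec as (C & hroot & happrox & hC & hiso).
  exists C. split; [assumption|]. split; [assumption|]. intros T.
  destruct (D_nagel T) as (V & r & p & d & hd & hr & hp & hV & hD).
  assert (compare : forall i j k, (1 <= i <= 10)%nat -> (1 <= j <= 10)%nat ->
    0 <= k -> k ^ 2 * sqdist8 j r p <= sqdist8 i r p -> k * D T 8 j <= D T 8 i)
    by (intros i j k hi hj hk h; rewrite (hD i hi), (hD j hj);
        apply scaled_sqrt_le; assumption).
  assert (compare_affine : forall i j k, (1 <= i <= 10)%nat ->
    (1 <= j <= 10)%nat -> i <> 6%nat -> j <> 6%nat -> 0 <= k ->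
    (forall t, -1 < t < 1 -> k * isosceles_dist j t <= isosceles_dist i t) ->
    k * D T 8 j <= D T 8 i)
    by (intros; apply compare; try assumption;
        apply affine_compare with d; assumption).
  pose proof (sqrt_pos 2) as s0. pose proof (pow2_sqrt 2 ltac:(lra)) as s2.
  assert (hs : 1.41 < sqrt 2 < 1.42) by (split; nra).
  (* These bounds replace the fraction in [isosceles_dist 7] in the comparisons of X_1 with X_7. *)
  assert (hinv : forall t, -1 < t < 1 -> 1 / 4 <= / (3 - t) <= 1 / 2).
  { intros t ht; split.
    - rewrite Rdiv_1_l; apply Rinv_le_contravar; lra.
    - rewrite Rdiv_1_l; apply Rinv_le_contravar; lra. }
  assert (D12 : 3 / 2 * D T 8 2 = D T 8 1).
  { apply Rle_antisym; [apply compare_affine; try lia; try lra;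
      intros; unfold isosceles_dist; lra|].
    assert (2 / 3 * D T 8 1 <= D T 8 2); [|lra].
    apply compare_affine; try lia; try lra; intros;
      unfold isosceles_dist; lra. }
  assert (D110 : 2 * D T 8 10 = D T 8 1).
  { apply Rle_antisym; [apply compare_affine; try lia; try lra;
      intros; unfold isosceles_dist; lra|].
    assert (1 / 2 * D T 8 1 <= D T 8 10); [|lra].
    apply compare_affine; try lia; try lra; intros;
      unfold isosceles_dist; lra. }
  assert (D14 : 1 * D T 8 1 <= D T 8 4)
    by (apply compare_affine; try lia; try lra; intros;
        unfold isosceles_dist; lra).
  assert (D15 : 3 / 4 * D T 8 1 <= D T 8 5)
    by (apply compare_affine; try lia; try lra; intros;
        unfold isosceles_dist; lra).
  assert (D54 : 4 / 3 * D T 8 5 <= D T 8 4)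
    by (apply compare_affine; try lia; try lra; intros;
        unfold isosceles_dist; lra).
  assert (D45 : 1 / 4 * D T 8 4 <= D T 8 5)
    by (apply compare_affine; try lia; try lra; intros;
        unfold isosceles_dist; lra).
  assert (D34 : 2 * D T 8 3 <= D T 8 4)
    by (apply compare_affine; try lia; try lra; intros; unfold isosceles_dist;
        unfold Rabs; destruct Rcase_abs; lra).
  assert (D35 : 1 / 2 * D T 8 3 <= D T 8 5)
    by (apply compare_affine; try lia; try lra; intros; unfold isosceles_dist;
        unfold Rabs; destruct Rcase_abs; lra).
  assert (D17 : 1 * D T 8 1 <= D T 8 7)
    by (apply compare_affine; try lia; try lra; intros t ht;
        specialize (hinv t ht); unfold isosceles_dist, Rdiv; nra).
  assert (D71 : 1 / 2 * D T 8 7 <= D T 8 1)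
    by (apply compare_affine; try lia; try lra; intros t ht;
        specialize (hinv t ht); unfold isosceles_dist, Rdiv in *; nra).
  assert (D91 : 2 * D T 8 9 <= D T 8 1).
  { apply compare_affine; try lia; try lra; intros t ht. unfold isosceles_dist.
    apply Rmult_le_reg_r with (3 - t); [lra|].
    replace (2 * ((1 - t) ^ 2 / (3 - t)) * (3 - t)) with (2 * (1 - t) ^ 2)
      by (field; lra).
    nra. }
  assert (D74 : 1 * D T 8 7 <= D T 8 4).
  { apply compare_affine; try lia; try lra; intros t ht. unfold isosceles_dist.
    apply Rmult_le_reg_r with (3 - t); [lra|].
    replace (1 * (4 * (1 - t) / (3 - t)) * (3 - t)) with (4 * (1 - t))
      by (field; lra).
    lra. }
  assert (D75 : 1 / 8 * (3 + 2 * sqrt 2) * D T 8 7 <= D T 8 5)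
    by (apply compare_affine; try lia; try lra;
        exact gergonne_le_nine_point).
  assert (D16 : 1 * D T 8 1 <= D T 8 6)
    by (apply compare; try lia; try lra;
        apply sqdist8_1_le_6 with d; assumption).
  assert (D61 : 2 / 7 * (4 - sqrt 2) * D T 8 6 <= D T 8 1)
    by (apply compare; try lia; try lra;
        apply sqdist8_6_le_1 with d; auto).
  assert (D64 : 1 * D T 8 6 <= D T 8 4)
    by (apply compare; try lia; try lra;
        apply sqdist8_6_le_4 with d; assumption).
  assert (D65 : C * D T 8 6 <= D T 8 5)
    by (apply compare; try lia; try lra;
        apply sqdist8_6_le_5 with d; assumption).
  assert (D76 : 2 / 3 * D T 8 7 <= D T 8 6)
    by (apply compare; try lia; try lra;
        apply sqdist8_7_le_6 with d; assumption).
  assert (D67 : 6 / 7 * D T 8 6 <= D T 8 7)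
    by (apply compare; try lia; try lra;
        apply sqdist8_6_le_7 with d; assumption).
  (* (2 + 1 / sqrt 2) * (4 - sqrt 2) = 7 *)
  assert (D610 : D T 8 6 <= (2 + 1 / sqrt 2) * D T 8 10).
  { replace (1 / sqrt 2) with (sqrt 2 / 2)
      by (rewrite <- sqrt2_inv; field; lra).
    assert (h : D T 8 6 =
                (2 + sqrt 2 / 2) / 2 * (2 / 7 * (4 - sqrt 2) * D T 8 6)
                + D T 8 6 * (sqrt 2 ^ 2 - 2) / 14) by field.
    rewrite s2 in h.
    assert ((2 + sqrt 2 / 2) / 2 * (2 / 7 * (4 - sqrt 2) * D T 8 6) <=
            (2 + sqrt 2 / 2) / 2 * D T 8 1)
      by (apply Rmult_le_compat_l; lra).
    rewrite <- D110 in *. lra. }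
  (* The other bounds are linear consequences: X_2 and X_10 reduce to X_1 by the two equalities,
     upper bounds are reciprocal forms, and the rest are chains through D(8,1). *)
  repeat split; lra.
Qed.
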